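(* Let $M$ be a closed manifold of dimension $d\ge1$ with a fixed Riemannian metric $g_0$, and let $\Lambda\ge0$. The map $$\pi_1:(\operatorname{Met}(M),G^{\mathrm{WE}})\to(\operatorname{Dens}(M),G^{\mathrm{WFR}}),\qquad g\mapsto\operatorname{vol}(g)$$ is a Riemannian submersion, where $\operatorname{Dens}(M)$ denotes the space of all smooth (positive) densities, $G^{\mathrm{WE}}$ is the Wasserstein--Ebin metric and $G^{\mathrm{WFR}}$ is the Wasserstein--Fisher--Rao metric.
   Context: $\operatorname{Met}(M)$ is the space of smooth Riemannian metrics on $M$, with tangent space $T_g\operatorname{Met}(M)=\Gamma^\infty(\operatorname{Sym}^2T^*M)$; $\operatorname{Dens}(M)$ is the space of smooth positive densities; $\mathfrak X(M)$ is the space of smooth vector fields; $\mathcal L$ is the Lie derivative; $\operatorname{vol}(g)$ is the volume density of $g$. The Wasserstein--Ebin metric is $$G^{\mathrm{WE}}_g(\delta g,\delta g)=\inf_{v,h}\ \int_M g_0(v,v)\operatorname{vol}(g)+\frac{d\Lambda}{4}\int_M\operatorname{tr}(g^{-1}hg^{-1}h)\operatorname{vol}(g),$$ the infimum over $v\in\mathfrak X(M)$, $h\in T_g\operatorname{Met}(M)$ with $\delta g=-\mathcal L_vg+h$. The Wasserstein--Fisher--Rao metric is $$G^{\mathrm{WFR}}_\rho(\delta\rho,\delta\rho)=\inf_{v,f}\ \int_M g_0(v,v)\rho+\Lambda\int_M f^2\rho,$$ the infimum over $v\in\mathfrak X(M)$ and smooth functions $f$ with $\delta\rho=-\mathcal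 L_v\rho+f\rho$. A map $\pi:(\mathcal N,G^{\mathcal N})\to(\mathcal P,G^{\mathcal P})$ between possibly infinite-dimensional manifolds with (weak, formal) Riemannian metrics is called a Riemannian submersion if $\pi$ is surjective, every $T_n\pi$ is surjective, and for every $n\in\mathcal N$ and $\xi\in T_{\pi(n)}\mathcal P$ one has $G^{\mathcal P}_{\pi(n)}(\xi,\xi)=\inf\{G^{\mathcal N}_n(\eta,\eta):\eta\in T_n\mathcal N,\ T_n\pi.\eta=\xi\}$. *)

(* Defs.v *)
From HB Require Import structures.
From mathcomp Require Import all_boot all_order all_algebra.
From mathcomp Require Import all_classical all_reals all_analysis.

Set Implicit Arguments.
Unset Strict Implicit.
Unset Printing Implicit Defensive.

Import Order.TTheory GRing.Theory Num.Theory.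
Import numFieldNormedType.Exports.

Local Open Scope classical_set_scope.
Local Open Scope ring_scope.

(* MathComp-Analysis has no manifolds.  A smooth structure on a topological space M
   is given by a smooth atlas, and a tensor field is given by its components in
   every chart of the atlas, subject to the tensor transformation law.  The
   components are functions of the point of M, and are 0 at the points outside
   of the domain of the chart, so that two fields are equal iff they are
   Leibniz equal. *)

Section Calculus.
Variables (R : realType) (d : nat).
Implicit Types (f : 'rV[R]_d -> R) (D : set 'rV[R]_d).

Definition partial (k : 'I_d) f (x : 'rV[R]_d) : R := 'D_(delta_mx 0 k) f x.

Definition partials (s : seq 'I_d) f : 'rV[R]_d -> R := foldr partial f s.

(* C^oo on D, which is always an open set below: all the iterated partial
   derivatives exist and are continuous at every point of D. *)
Definition smooth_on D f : Prop :=
  forall (s : seq 'I_d) x, D x ->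
    {for x, continuous (partials s f)} /\
    forall k, derivable (partials s f) x (delta_mx 0 k).

End Calculus.

(* The Lebesgue integral over R^d, as an iterated integral (Tonelli/Fubini). *)
Fixpoint integral_rV (R : realType) (d : nat) :
    ('rV[R]_d -> \bar R) -> \bar R :=
  match d return ('rV[R]_d -> \bar R) -> \bar R with
  | 0%N => fun f => f 0
  | n.+1 => fun f =>
      (\int[lebesgue_measure]_t
         integral_rV (fun x : 'rV[R]_n =>
           f (row_mx (const_mx t : 'rV[R]_1) x)))%E
  end.

Record atlas (R : realType) (d : nat) (M : topologicalType) := Atlas {
  chart :> Type;
  dom : chart -> set M;
  img : chart -> set 'rV[R]_d;
  coord : chart -> M -> 'rV[R]_d;
  param : chart -> 'rV[R]_d -> M;
  dom_open : forall i, open (dom i);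
  img_open : forall i, open (img i);
  coord_img : forall i p, dom i p -> img i (coord i p);
  param_dom : forall i x, img i x -> dom i (param i x);
  coordK : forall i p, dom i p -> param i (coord i p) = p;
  paramK : forall i x, img i x -> coord i (param i x) = x;
  coord_continuous : forall i p, dom i p -> {for p, continuous (coord i)};
  param_continuous : forall i x, img i x -> {for x, continuous (param i)};
  dom_cover : forall p, exists i, dom i p;
  transition_smooth : forall i j k,
    smooth_on (img i `&` param i @^-1` dom j)
              (fun x => coord j (param i x) 0 k)
}.

Section Fields.
Variables (R : realType) (d : nat) (M : topologicalType) (A : atlas R d M).

(* Jac i j p is the matrix (dx_j^l / dx_i^k)_(k, l) at p, to be multiplied by
   row vectors on its left. *)
Definition Jac (i j : A) (p : M) : 'M[R]_d :=
  jacobian (coord j \o param i) (coord i p).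

Definition smooth_fun (f : M -> R) : Prop :=
  forall i : A, smooth_on (img i) (f \o param i).

Definition vector_fields : set (A -> M -> 'rV[R]_d) :=
  [set v : A -> M -> 'rV[R]_d | [/\ forall i p, ~ dom i p -> v i p = 0,
    forall i k, smooth_on (img i) (fun x => v i (param i x) 0 k) &
    forall i j p, dom i p -> dom j p -> v j p = v i p *m Jac i j p]].

Definition sym2_fields : set (A -> M -> 'M[R]_d) :=
  [set h : A -> M -> 'M[R]_d | [/\ forall i p, ~ dom i p -> h i p = 0,
    forall i k l, smooth_on (img i) (fun x => h i (param i x) k l),
    forall i p, (h i p)^T = h i p &
    forall i j p, dom i p -> dom j p ->
      h i p = Jac i j p *m h j p *m (Jac i j p)^T]].

Definition quad (B : 'M[R]_d) (u : 'rV[R]_d) : R := (u *m B *m u^T) 0 0.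

Definition metrics : set (A -> M -> 'M[R]_d) :=
  [set g | sym2_fields g /\
    forall i p, dom i p -> forall u, u != 0 -> 0 < quad (g i p) u].

(* Smooth sections of the density bundle, of arbitrary sign. *)
Definition density_fields : set (A -> M -> R) :=
  [set mu : A -> M -> R | [/\ forall i p, ~ dom i p -> mu i p = 0,
    forall i, smooth_on (img i) (mu i \o param i) &
    forall i j p, dom i p -> dom j p ->
      mu i p = mu j p * `|\det (Jac i j p)|]].

Definition densities : set (A -> M -> R) :=
  [set rho | density_fields rho /\ forall i p, dom i p -> 0 < rho i p].

Definition vol (g : A -> M -> 'M[R]_d) : A -> M -> R :=
  fun i p => Num.sqrt (\det (g i p)).

(* (L_v g)_kl = v^m d_m g_kl + g_ml d_k v^m + g_km d_l v^m.
   This and [lie_density] are meaningful on the domain of the chart only. *)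
Definition lie_metric (v : A -> M -> 'rV[R]_d) (g : A -> M -> 'M[R]_d) :
    A -> M -> 'M[R]_d :=
  fun i p => \matrix_(k, l) \sum_(m < d)
    (v i p 0 m * partial m (fun x => g i (param i x) k l) (coord i p)
     + g i p m l * partial k (fun x => v i (param i x) 0 m) (coord i p)
     + g i p k m * partial l (fun x => v i (param i x) 0 m) (coord i p)).

(* L_v rho = d_m (rho v^m) *)
Definition lie_density (v : A -> M -> 'rV[R]_d) (rho : A -> M -> R) :
    A -> M -> R :=
  fun i p => \sum_(m < d)
    partial m (fun x => rho i (param i x) * v i (param i x) 0 m) (coord i p).

Record partition_of_unity := PartitionOfUnity {
  pou_size : nat;
  pou_chart : 'I_pou_size -> A;
  pou_fun : 'I_pou_size -> M -> R;
  pou_smooth : forall k, smooth_fun (pou_fun k);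
  pou_ge0 : forall k p, 0 <= pou_fun k p;
  pou_supp : forall k,
    closure [set p | pou_fun k p != 0] `<=` dom (pou_chart k);
  pou_sum : forall p, \sum_k pou_fun k p = 1
}.

(* The integral over M of the density mu, computed with the partition of
   unity chi; by the change of variables formula it does not depend on chi. *)
Definition density_integral (chi : partition_of_unity) (mu : A -> M -> R) :
    \bar R :=
  (\sum_(k < pou_size chi)
     let i := pou_chart k in
     integral_rV (fun x : 'rV[R]_d =>
       if x \in img i
       then (pou_fun k (param i x) * mu i (param i x))%:E else 0))%E.

Definition WE_metric (chi : partition_of_unity) (g0 : A -> M -> 'M[R]_d)
    (Lambda : R) (g dg : A -> M -> 'M[R]_d) : \bar R :=
  ereal_inf [set c | exists v h,
    [/\ vector_fields v, sym2_fields h,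
        (forall i p, dom i p -> dg i p = - lie_metric v g i p + h i p) &
        c = (density_integral chi
               (fun i p => (quad (g0 i p) (v i p) * vol g i p)%R)
             + (d%:R * Lambda / 4)%:E * density_integral chi
               (fun i p => (\tr (invmx (g i p) *m h i p *m
                                 invmx (g i p) *m h i p) * vol g i p)%R))%E]].

Definition WFR_metric (chi : partition_of_unity) (g0 : A -> M -> 'M[R]_d)
    (Lambda : R) (rho drho : A -> M -> R) : \bar R :=
  ereal_inf [set c | exists v f,
    [/\ vector_fields v, smooth_fun f,
        (forall i p, dom i p ->
           drho i p = - lie_density v rho i p + f p * rho i p) &
        c = (density_integral chi
               (fun i p => (quad (g0 i p) (v i p) * rho i p)%R)
             + Lambda%:E * density_integral chi
               (fun i p => (f p ^+ 2 * rho i p)%R))%E]].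

End Fields.

Section FormalRiemannian.
Variables (R : realType) (C M : Type).

(* A set of sections, with its tangent spaces and a quadratic form on each.
   The quadratic form is [\bar R]-valued because infima and integrals are. *)
Record formal_riemannian (V : normedModType R) := FormalRiemannian {
  points : set (C -> M -> V);
  tangent : (C -> M -> V) -> set (C -> M -> V);
  normsq : (C -> M -> V) -> (C -> M -> V) -> \bar R
}.

Variables V W : normedModType R.
Implicit Types (pi : (C -> M -> V) -> (C -> M -> W)).

(* T_n pi . eta, the derivative of pi (n + t eta) at t = 0. *)
Definition tangent_map pi (n eta : C -> M -> V) : C -> M -> W :=
  fun i p => derive1 (fun t : R => pi (n + t *: eta) i p) 0.

Definition riemannian_submersion (N : formal_riemannian V)
    (P : formal_riemannian W) pi : Prop :=
  [/\ set_fun (points N) (points P) pi,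
      (forall n eta, points N n -> tangent N n eta ->
         (forall i p, derivable (fun t : R => pi (n + t *: eta) i p) 0 1) /\
         tangent P (pi n) (tangent_map pi n eta)),
      set_surj (points N) (points P) pi,
      (forall n, points N n ->
         set_surj (tangent N n) (tangent P (pi n)) (tangent_map pi n)) &
      forall n xi, points N n -> tangent P (pi n) xi ->
        normsq P (pi n) xi =
          ereal_inf [set normsq N n eta | eta in
            [set eta | tangent N n eta /\ tangent_map pi n eta = xi]]].

End FormalRiemannian.

Section MetDens.
Variables (R : realType) (d : nat) (M : topologicalType) (A : atlas R d M).
Variables (chi : partition_of_unity A) (g0 : A -> M -> 'M[R]_d) (Lambda : R).

Definition Met_WE : formal_riemannian A M 'M[R]_d :=
  FormalRiemannian (@metrics R d M A) (fun _ => @sym2_fields R d M A)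
    (WE_metric chi g0 Lambda).

Definition Dens_WFR : formal_riemannian A M R :=
  FormalRiemannian (@densities R d M A) (fun _ => @density_fields R d M A)
    (WFR_metric chi g0 Lambda).

End MetDens.

(* Main.v *)
From HB Require Import structures.
Require Import Defs.
From mathcomp Require Import all_boot all_order all_algebra.
From mathcomp Require Import all_classical all_reals all_analysis.
From mathcomp Require Import perm ring.
Local Open Scope ring_scope.

(** For a metric g and a symmetric tensor h, the derivative of vol at g in the
    direction h is (tr (g^-1 h) / 2) vol(g), and it maps L_v g to L_v vol(g).
    Hence a decomposition dg = - L_v g + h is mapped to the decomposition
    - L_v vol(g) + f vol(g) with f = tr (g^-1 h) / 2.  Cauchy-Schwarz gives
    f^2 <= (d / 4) tr (g^-1 h g^-1 h), with equality for h = (2 / d) f g, so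
    that the two infima agree.  Surjectivity is obtained by conformal changes
    of g0.  The one point that uses the second derivatives of the transition
    maps is that L_v g is a tensor field: their mixed partial derivatives
    commute. *)

Set Implicit Arguments.
Unset Strict Implicit.
Unset Printing Implicit Defensive.
Import Order.TTheory GRing.Theory Num.Theory.
Import numFieldNormedType.Exports.
Local Open Scope classical_set_scope.

(** * Smooth functions *)

(** Both squared norms are themselves infima, so the infimum of the Wasserstein--Ebin cost over a
    fibre of the derivative amounts to one infimum over pairs [(v, h)]. The field [v] is kept
    throughout, so the transport terms coincide and only the source terms are compared. The weight
    [d * Lambda / 4] is the one that absorbs the constant of Cauchy-Schwarz. Costs live in the
    extended reals, and integrals are compared only through inequalities carrying a constant factor.
    Smoothness is phrased with iterated partial derivatives, while changing charts requires the
    chain rule; Fréchet differentiability and the symmetry of second derivatives therefore come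
    first. Fields are equal when their components are equal at all points, including those outside
    the chart, so every identity between fields has a second case there; for [vol] this case relies
    on [d] being positive. *)

Lemma is_derive_comp1 (R : realType) (V : normedModType R) (f : V -> R)
    (g : R -> R) (x v : V) (df dg : R) :
  is_derive x v f df -> is_derive (f x) 1 g dg ->
  is_derive x v (g \o f) (dg * df).
Proof.
move=> [fd fE] gd.
(* Only the derivative along [v] is known to exist, so everything is restricted to the line through
   [x] directed by [v], where the one-variable chain rule applies. *)
have lineE (h : V -> R) : 'D_v h x = 'D_1 (fun t : R => h (t *: v + x)) 0.
  rewrite /derive; set F := (X in X @ _); set G := (X in _ = lim (X @ _)).
  have -> : F = G.
    by apply/funext => t; rewrite /F /G /= addr0 scale0r add0r [_%:A]mulr1.
  by [].
have fl : is_derive (0 : R) 1 (fun t : R => f (t *: v + x)) df.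
  by apply: DeriveDef; [exact: (derivable1P f x v).1 | rewrite -lineE].
have gl : is_derive (f (0 *: v + x)) 1 g dg by rewrite scale0r add0r.
have [cd cE] := @is_derive1_comp _ _ (fun t : R => f (t *: v + x)) _ _ _ gl fl.
by apply: DeriveDef; [exact/(derivable1P (g \o f)) | rewrite lineE -cE].
Qed.

Section SmoothFunctions.
Variables (R : realType) (d : nat).
Implicit Types (f g : 'rV[R]_d -> R) (D : set 'rV[R]_d).

Lemma near_eq_on D f g x : open D -> D x -> (forall y, D y -> f y = g y) ->
  \near x, f x = g x.
Proof. by move=> oD Dx fg; apply: (filterS fg); exact: open_nbhs_nbhs. Qed.

Lemma partial_eq_on D f g k x : open D -> D x ->
  (forall y, D y -> f y = g y) -> partial k f x = partial k g x.
Proof.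
by move=> oD Dx fg; apply: near_eq_derive; exact: near_eq_on oD Dx fg.
Qed.

Lemma continuous_eq_on D f g x : open D -> D x ->
  (forall y, D y -> f y = g y) ->
  {for x, continuous f} -> {for x, continuous g}.
Proof.
move=> oD Dx fg cf; rewrite /prop_for /continuous_at -(fg x Dx).
apply: cvg_trans cf.
exact: (@near_eq_cvg _ _ (nbhs x) _ _ _ (near_eq_on oD Dx fg)).
Qed.

Lemma smooth_on_continuous D f x : smooth_on D f -> D x ->
  {for x, continuous f}.
Proof. by move=> sf Dx; case: (sf [::] x Dx). Qed.

Lemma smooth_on_derivable D f x k : smooth_on D f -> D x ->
  derivable f x (delta_mx 0 k).
Proof. by move=> sf Dx; case: (sf [::] x Dx) => _; apply. Qed.

Lemma smooth_on_is_derive D f x k : smooth_on D f -> D x ->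
  is_derive x (delta_mx 0 k) f (partial k f x).
Proof.
by move=> sf Dx; apply: DeriveDef => //; exact: smooth_on_derivable sf Dx.
Qed.

Lemma smooth_on_partial D f k : smooth_on D f -> smooth_on D (partial k f).
Proof.
move=> sf s x Dx; have := sf (rcons s k) x Dx.
by rewrite /partials -cats1 foldr_cat.
Qed.

(* Every member is continuous with partial derivatives, and the class is stable
   under partial differentiation; so all its members are smooth. *)
Inductive smooth_closure D : ('rV[R]_d -> R) -> Prop :=
| SmoothBase f : smooth_on D f -> smooth_closure D f
| SmoothCst c : smooth_closure D (fun=> c)
| SmoothAdd f g : smooth_closure D f -> smooth_closure D g ->
    smooth_closure D (fun x => f x + g x)
| SmoothMul f g : smooth_closure D f -> smooth_closure D g ->
    smooth_closure D (fun x => f x * g x)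
| SmoothPow a f : (forall x, D x -> 0 < f x) -> smooth_closure D f ->
    smooth_closure D (fun x => f x `^ a)
| SmoothEq f g : (forall x, D x -> f x = g x) -> smooth_closure D f ->
    smooth_closure D g.

(** Real powers keep the class stable: differentiating [f] to the power [a] produces the power
    [a - 1], again of the same kind. Reciprocals and square roots are both instances. *)
Lemma smooth_closure_partial D f : open D -> smooth_closure D f ->
  (forall x, D x -> {for x, continuous f}
     /\ forall k, derivable f x (delta_mx 0 k))
  /\ forall k, smooth_closure D (partial k f).
Proof.
move=> oD; elim=> {f}.
- move=> f sf; split=> [x Dx|k]; first by case: (sf [::] x Dx).
  exact/SmoothBase/smooth_on_partial.
- move=> c; split=> [x _|k]; first by split=> [|k]; [exact: cst_continuous|].
  by apply: (SmoothEq _ (SmoothCst D 0)) => x _; rewrite /partial derive_cst.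
- move=> f g _ [f1 f2] _ [g1 g2]; split=> [x Dx|k].
    have [[cf df] [cg dg]] := (f1 x Dx, g1 x Dx); split=> [|k].
      exact: continuousD.
    exact: derivableD.
  apply: (SmoothEq _ (SmoothAdd (f2 k) (g2 k))) => x Dx.
  have [[cf df] [cg dg]] := (f1 x Dx, g1 x Dx).
  by rewrite /partial -deriveD.
- move=> f g sf [f1 f2] sg [g1 g2]; split=> [x Dx|k].
    have [[cf df] [cg dg]] := (f1 x Dx, g1 x Dx); split=> [|k].
      exact: continuousM.
    exact: derivableM.
  apply: (SmoothEq _ (SmoothAdd (SmoothMul sf (g2 k)) (SmoothMul sg (f2 k)))).
  move=> x Dx; have [[cf df] [cg dg]] := (f1 x Dx, g1 x Dx).
  by rewrite /partial deriveM.
- move=> a f f0 sf [f1 f2].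
  have D_pow x k : D x -> is_derive x (delta_mx 0 k) (fun y => f y `^ a)
      (a * f x `^ (a - 1) * partial k f x).
    move=> Dx; have [cf df] := f1 x Dx.
    have dp := is_derive1_powR a (f0 x Dx).
    have df' := derivableP (df k).
    exact: (@is_derive_comp1 _ _ f (fun y => y `^ a) _ _ _ _ df' dp).
  split=> [x Dx|k].
    split=> [|k]; last by have [] := D_pow x k Dx.
    have [cf df] := f1 x Dx.
    apply: (@continuous_comp _ _ _ f (fun y => y `^ a)) => //.
    apply/differentiable_continuous/derivable1_diffP.
    by have [] := is_derive1_powR a (f0 x Dx).
  apply: (@SmoothEq _ (fun x => a * f x `^ (a - 1) * partial k f x)).
    by move=> x Dx; have [_ <-] := D_pow x k Dx.
  apply: SmoothMul (f2 k); apply: SmoothMul; first exact: SmoothCst.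
  exact: SmoothPow.
- move=> f g fg _ [f1 f2]; split=> [x Dx|k].
    have [cf df] := f1 x Dx; split=> [|k].
      exact: continuous_eq_on fg cf.
    exact: near_eq_derivable (near_eq_on oD Dx fg) (df k).
  by apply: SmoothEq (f2 k) => x Dx; exact: (partial_eq_on k oD Dx fg).
Qed.

Lemma smooth_closureP D f : open D -> smooth_closure D f -> smooth_on D f.
Proof.
move=> oD sf s; have [s' ->] : exists s', s = rev s'.
  by exists (rev s); rewrite revK.
elim: s' f sf => [|k s' IH] f sf x Dx.
  by have [+ _] := smooth_closure_partial oD sf; apply.
have [_ /(_ k) sk] := smooth_closure_partial oD sf.
by rewrite /partials rev_cons -cats1 foldr_cat; exact: IH.
Qed.

Variable D : set 'rV[R]_d.
Hypothesis oD : open D.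

Lemma smooth_on_eq f g : (forall x, D x -> f x = g x) ->
  smooth_on D f -> smooth_on D g.
Proof. by move=> fg /SmoothBase sf; exact/smooth_closureP/(SmoothEq fg). Qed.

Lemma smooth_on_cst c : smooth_on D (fun=> c).
Proof. exact/smooth_closureP/SmoothCst. Qed.

Lemma smooth_onD f g : smooth_on D f -> smooth_on D g ->
  smooth_on D (fun x => f x + g x).
Proof.
by move=> /SmoothBase sf /SmoothBase sg; exact/smooth_closureP/SmoothAdd.
Qed.

Lemma smooth_onM f g : smooth_on D f -> smooth_on D g ->
  smooth_on D (fun x => f x * g x).
Proof.
by move=> /SmoothBase sf /SmoothBase sg; exact/smooth_closureP/SmoothMul.
Qed.

Lemma smooth_on_powR a f : (forall x, D x -> 0 < f x) -> smooth_on D f ->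
  smooth_on D (fun x => f x `^ a).
Proof. by move=> f0 /SmoothBase sf; exact/smooth_closureP/SmoothPow. Qed.

Lemma smooth_onV f : (forall x, D x -> 0 < f x) -> smooth_on D f ->
  smooth_on D (fun x => (f x)^-1).
Proof.
move=> f0 sf; apply: (smooth_on_eq _ (smooth_on_powR (-1) f0 sf)) => x Dx.
by rewrite powRN powRr1 // ltW ?f0.
Qed.

Lemma smooth_on_sqrt f : (forall x, D x -> 0 < f x) -> smooth_on D f ->
  smooth_on D (fun x => Num.sqrt (f x)).
Proof.
move=> f0 sf; apply: (smooth_on_eq _ (smooth_on_powR 2^-1 f0 sf)) => x Dx.
by rewrite -powR12_sqrt // ltW ?f0.
Qed.

Lemma smooth_on_sum (I : Type) (r : seq I) (P : pred I)
    (F : I -> 'rV[R]_d -> R) : (forall i, P i -> smooth_on D (F i)) ->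
  smooth_on D (fun x => \sum_(i <- r | P i) F i x).
Proof.
move=> sF; elim: r => [|i r IH].
  by apply: (smooth_on_eq _ (smooth_on_cst 0)) => x _; rewrite big_nil.
have [Pi|nPi] := boolP (P i).
  apply: (smooth_on_eq _ (smooth_onD (sF i Pi) IH)) => x _.
  by rewrite big_cons Pi.
by apply: (smooth_on_eq _ IH) => x _; rewrite big_cons (negbTE nPi).
Qed.

Lemma smooth_on_prod (I : Type) (r : seq I) (P : pred I)
    (F : I -> 'rV[R]_d -> R) : (forall i, P i -> smooth_on D (F i)) ->
  smooth_on D (fun x => \prod_(i <- r | P i) F i x).
Proof.
move=> sF; elim: r => [|i r IH].
  by apply: (smooth_on_eq _ (smooth_on_cst 1)) => x _; rewrite big_nil.
have [Pi|nPi] := boolP (P i).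
  apply: (smooth_on_eq _ (smooth_onM (sF i Pi) IH)) => x _.
  by rewrite big_cons Pi.
by apply: (smooth_on_eq _ IH) => x _; rewrite big_cons (negbTE nPi).
Qed.

Lemma smooth_on_det n (B : 'rV[R]_d -> 'M[R]_n) :
  (forall k l, smooth_on D (fun x => B x k l)) ->
  smooth_on D (fun x => \det (B x)).
Proof.
move=> sB; apply: smooth_on_sum => s _.
by apply: smooth_onM; [exact: smooth_on_cst | apply: smooth_on_prod].
Qed.

Lemma smooth_on_mulmx m n p (B : 'rV[R]_d -> 'M[R]_(m, n))
    (C : 'rV[R]_d -> 'M[R]_(n, p)) :
  (forall k l, smooth_on D (fun x => B x k l)) ->
  (forall k l, smooth_on D (fun x => C x k l)) ->
  forall k l, smooth_on D (fun x => (B x *m C x) k l).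
Proof.
move=> sB sC k l.
apply: (@smooth_on_eq (fun x => \sum_j B x k j * C x j l)).
  by move=> x _; rewrite mxE.
by apply: smooth_on_sum => j _; exact: smooth_onM.
Qed.

(** Cramer's rule: the entries are cofactors divided by the determinant, whose positivity makes its
    reciprocal smooth. *)
Lemma smooth_on_invmx n (B : 'rV[R]_d -> 'M[R]_n) :
  (forall x, D x -> 0 < \det (B x)) ->
  (forall k l, smooth_on D (fun x => B x k l)) ->
  forall k l, smooth_on D (fun x => invmx (B x) k l).
Proof.
move=> B0 sB k l.
apply: (@smooth_on_eq (fun x => (\det (B x))^-1 * cofactor (B x) l k)).
  move=> x Dx; rewrite /invmx unitmxE unitfE gt_eqF ?B0 //.
  by rewrite mxE [X in _ = _ * X]mxE.
apply: smooth_onM; first by apply: smooth_onV => //; exact: smooth_on_det.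
apply: smooth_onM; first exact: smooth_on_cst.
apply: smooth_on_det => a b.
by apply: (smooth_on_eq _ (sB (lift l a) (lift k b))) => x _; rewrite !mxE.
Qed.

End SmoothFunctions.

(** * Partial derivatives *)

(** Bounding by absolute values gives one form of the mean value theorem for increments [s] of
    either sign, as needed for the coordinates of an arbitrary vector. *)
Lemma MVT0 (R : realType) (f df : R -> R) (s : R) :
  (forall t : R, `|t| <= `|s| -> is_derive t 1 f (df t)) ->
  exists2 c, `|c| <= `|s| & f s - f 0 = s * df c.
Proof.
move=> fd.
have cf (a b : R) : (forall t, t \in `[a, b]%R -> `|t| <= `|s|) ->
    {within `[a, b], continuous f}.
  move=> ab; apply: derivable_within_continuous => t tab.
  by have [] := fd t (ab t tab).
have [s0|s0] := leP 0 s.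
  have le t : t \in `[0, s]%R -> `|t| <= `|s|.
    by rewrite in_itv /= => /andP[t0 ts]; rewrite !ger0_norm.
  have [t|c cs ->] := @MVT_segment _ f df 0 s s0 _ (cf _ _ le).
    by move=> /subset_itv_oo_cc ts; exact/fd/le.
  by exists c; [exact: le | rewrite subr0 mulrC].
have le t : t \in `[s, 0]%R -> `|t| <= `|s|.
  by rewrite in_itv /= => /andP[st t0]; rewrite !ler0_norm ?lerN2 // ltW.
have [t|c cs E] := @MVT_segment _ f df s 0 (ltW s0) _ (cf _ _ le).
  by move=> /subset_itv_oo_cc ts; exact/fd/le.
exists c; first exact: le.
by rewrite -opprB E sub0r mulrN opprK mulrC.
Qed.

Lemma is_derive_line (R : realType) (V : normedModType R) (f : V -> R)
    (y v : V) (t df : R) : is_derive (y + t *: v) v f df ->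
  is_derive t 1 (fun s => f (y + s *: v)) df.
Proof.
move=> [fd <-].
have E : (fun h : R => h^-1 *: (f (h *: v + (y + t *: v)) - f (y + t *: v)))
    = (fun h => h^-1 *: (f (y + (h *: 1 + t) *: v) - f (y + t *: v))).
  apply/funext => h; congr (_ *: (f _ - _)).
  by rewrite scalerDl [h *: 1]mulr1 addrCA.
by apply: DeriveDef; rewrite /derivable /derive /= -E.
Qed.

Lemma rV_norm_le (R : realType) d (v : 'rV[R]_d) e : 0 <= e ->
  (forall j, `|v 0 j| <= e) -> `|v| <= e.
Proof.
move=> e0 ve; rewrite [leLHS]/Num.Def.normr /= mx_normrE.
by apply: bigmax_le => //= -[i j] _; rewrite ord1.
Qed.

Lemma rV_coord_le_norm (R : realType) d (v : 'rV[R]_d) j : `|v 0 j| <= `|v|.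
Proof.
rewrite [leRHS]/Num.Def.normr /= mx_normrE.
by apply: (le_bigmax _ _ (0, j)).
Qed.

Lemma ler_dist_half (R : realType) (c a b e : R) :
  `|c - a| <= e / 2 -> `|c - b| <= e / 2 -> `|a - b| <= e.
Proof.
move=> ca cb; rewrite -(subrKA c) (le_trans (ler_normD _ _)) //.
by rewrite (splitr e) lerD // distrC.
Qed.

(** * Fréchet differentiability and symmetry of second derivatives *)

Section Calculus.
Variables (R : realType) (d : nat).
Implicit Types (f g : 'rV[R]_d -> R) (D : set 'rV[R]_d) (x : 'rV[R]_d).

Lemma diff_rV_sum f x (h : 'rV[R]_d) :
  'd f x h = \sum_k h 0 k * 'd f x (delta_mx 0 k).
Proof.
rewrite [in LHS](matrix_sum_delta h) big_ord1 linear_sum /=.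
by apply: eq_bigr => k _; rewrite linearZ.
Qed.

Lemma smooth_on_near D f x e : open D -> smooth_on D f -> D x -> 0 < e ->
  exists2 r, 0 < r & forall y, `|y - x| < r ->
    D y /\ forall k, `|partial k f y - partial k f x| <= e.
Proof.
move=> oD sf Dx e0.
have : \forall y \near x, D y /\ forall k, `|partial k f y - partial k f x| <= e.
  near=> y; split; first by near: y; exact: open_nbhs_nbhs.
  move=> k; move: k; near: y; apply: filter_forall => k.
  have /cvgrPdist_le/(_ _ e0) := smooth_on_continuous (smooth_on_partial k sf) Dx.
  by apply: filterS => y; rewrite distrC.
move=> /nbhs_normP[r /= r0 rP]; exists r => // y xy; apply: rP => /=.
by rewrite /= distrC.
Unshelve. all: by end_near. Qed.

(* Moving from x to x + h along the coordinate axes, one coordinate at a time. *)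
Lemma smooth_on_increment D f x (h : 'rV[R]_d) r : smooth_on D f ->
  (forall y, `|y - x| < r -> D y) -> `|h| < r ->
  exists2 y : 'I_d -> 'rV[R]_d, (forall k, `|y k - x| <= `|h|) &
    f (x + h) - f x = \sum_k h 0 k * partial k f (y k).
Proof.
move=> sf rD hr.
pose tr k : 'rV[R]_d := \row_j (if (j < k)%N then h 0 j else 0).
have trS (k : 'I_d) : tr k.+1 = tr k + h 0 k *: delta_mx 0 k.
  apply/rowP => j; rewrite !mxE /= ltnS leq_eqVlt.
  have [->|jk] := eqVneq j k; first by rewrite eqxx ltnn /= mulr1 add0r.
  by rewrite (negbTE jk : (j == k :> nat) = false) /= mulr0 addr0.
(* The norm is the maximum of the coordinates, so the whole broken path from [x] to [x + h] stays
   within distance [|h|] of [x]. *)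
have le_tr (k : 'I_d) c : `|c| <= `|h 0 k| -> `|tr k + c *: delta_mx 0 k| <= `|h|.
  move=> ch; apply: rV_norm_le => // j; rewrite !mxE /=.
  have [->|jk] := eqVneq j k.
    by rewrite ltnn add0r mulr1 (le_trans ch) // rV_coord_le_norm.
  by rewrite mulr0 addr0; case: ifP => _; rewrite ?normr0 ?rV_coord_le_norm.
have /choice[y yP] : forall k : 'I_d, exists y, `|y - x| <= `|h| /\
    f (x + tr k.+1) - f (x + tr k) = h 0 k * partial k f y.
  move=> k; have [c|c ch E] := @MVT0 _ (fun t => f (x + tr k + t *: delta_mx 0 k))
      (fun t => partial k f (x + tr k + t *: delta_mx 0 k)) (h 0 k).
    move=> ch; apply: is_derive_line; apply: smooth_on_is_derive sf _.
    apply: rD; rewrite -[x + _ + _]addrA [x + _]addrC addrK.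
    by rewrite (le_lt_trans _ hr) // le_tr.
  exists (x + tr k + c *: delta_mx 0 k); split.
    by rewrite -[x + _ + _]addrA [x + _]addrC addrK le_tr.
  by rewrite trS addrA -E scale0r addr0.
exists y => [k|]; first by have [] := yP k.
have <- : x + tr d = x + h.
  by congr (_ + _); apply/rowP => j; rewrite mxE ltn_ord.
have <- : f (x + tr 0%N) = f x.
  by congr f; rewrite -[RHS]addr0; congr (_ + _); apply/rowP => j; rewrite !mxE.
have := telescope_sumr (fun k => f (x + tr k)) (leq0n d).
by rewrite big_mkord => <-; apply: eq_bigr => k _; have [] := yP k.
Qed.

(** Continuity of the partial derivatives does it: each edge of the path along the axes contributes
    a partial derivative at a point close to [x], hence close to its value at [x]. *)
Lemma smooth_on_differentiable D f x : open D -> smooth_on D f -> D x ->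
  differentiable f x.
Proof.
move=> oD sf Dx.
pose df (h : 'rV[R]_d) : R := \sum_k h 0 k * partial k f x.
have lin_df : linear df.
  move=> a u v; rewrite /df scaler_sumr -big_split /=; apply: eq_bigr => k _.
  by rewrite !mxE mulrDl -mulrA.
pose dfM := GRing.isLinear.Build _ _ _ _ _ lin_df.
pose dfL : {linear 'rV[R]_d -> R} := HB.pack df dfM.
have c_df : continuous dfL.
  apply: continuous_big => [|k _ y]; first exact: add_continuous.
  apply: (@continuousM _ _ (fun h : 'rV[R]_d => h 0 k) (cst _)).
    exact: coord_continuous.
  exact: cst_continuous.
suff small (e : R) : 0 < e ->
    \forall h \near (0 : 'rV[R]_d), `|f (h + x) - (f x + df h)| <= e * `|h|.
  have dE : 'd f x = dfL :> (_ -> _).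
    by apply: (diff_unique c_df); apply/eqaddoP => e /small.
  by apply/diff_locallyP; rewrite dE; split=> //; apply/eqaddoP => e /small.
(* The [d] edges each contribute at most this fraction of [e]; the denominator [d + 1] is nonzero
   even when [d = 0]. *)
move=> e0; have e'0 : 0 < e / d.+1%:R by rewrite divr_gt0.
have [r r0 rP] := smooth_on_near oD sf Dx e'0.
apply/nbhs_normP; exists r => // h /=; rewrite sub0r normrN => hr.
have [y yh] := smooth_on_increment sf (fun y yr => (rP y yr).1) hr.
rewrite [h + x]addrC opprD addrA => ->.
rewrite /df -sumrB.
apply: (@le_trans _ _ (\sum_(k < d) e / d.+1%:R * `|h|)).
  apply: le_trans (ler_norm_sum _ _ _) _; apply: ler_sum => k _.
  rewrite -mulrBr normrM mulrC ler_pM ?rV_coord_le_norm //.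
  by apply: (rP _ _).2; rewrite (le_lt_trans (yh k)).
rewrite sumr_const card_ord -[_ *+ d]mulr_natr mulrAC; apply: ler_wpM2r => //.
by rewrite -mulrA ger_pMr // mulrC ler_pdivrMr ?ltr0n // mul1r ler_nat leqnSn.
Qed.

Lemma partialE f x k : differentiable f x ->
  partial k f x = 'd f x (delta_mx 0 k).
Proof. by move=> df; rewrite /partial deriveE. Qed.

Lemma smooth_on_partialC D f x k l : open D -> smooth_on D f -> D x ->
  partial k (partial l f) x = partial l (partial k f) x.
Proof.
move=> oD sf Dx; apply/eqP; rewrite -subr_eq0 -normr_le0.
apply/ler_addgt0Pr => e e0; rewrite add0r; have e2 : 0 < e / 2 by rewrite divr_gt0.
have [r1 r10 rP1] := smooth_on_near oD (smooth_on_partial l sf) Dx e2.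
have [r2 r20 rP2] := smooth_on_near oD (smooth_on_partial k sf) Dx e2.
(* Points of the square of side [r] are within [2 r] of [x]; taking a third of the radius makes the
   bound strict. *)
have [r r0 rE] : exists2 r, 0 < r & Num.min r1 r2 = r + r + r.
  exists (Num.min r1 r2 / 3); first by rewrite divr_gt0 // lt_min r10.
  by field.
have e1 j : `|delta_mx 0 j : 'rV[R]_d| <= 1.
  apply: rV_norm_le => // i; rewrite mxE eqxx /=.
  by case: eqP; rewrite ?normr1 ?normr0.
have near_pt a b i j : `|a| <= r -> `|b| <= r ->
    `|x + a *: delta_mx 0 i + b *: delta_mx 0 j - x| < Num.min r1 r2.
  move=> ar br; rewrite -[x + _ + _]addrA [x + _]addrC addrK.
  rewrite (le_lt_trans (ler_normD _ _)) //.
  rewrite !normrZ (@le_lt_trans _ _ (r + r)) //.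
    by rewrite lerD // -[leRHS]mulr1 ler_pM.
  by rewrite rE ltrDl.
(* The second difference of f over a square with sides along k and l is r^2
   times either mixed derivative, at some point of the square. *)
have second i j : exists2 y, `|y - x| < Num.min r1 r2 &
   f (x + r *: delta_mx 0 j + r *: delta_mx 0 i) - f (x + r *: delta_mx 0 i)
   - (f (x + r *: delta_mx 0 j) - f x) = r * (r * partial j (partial i f) y).
  have inD a b i' j' : `|a| <= `|r| -> `|b| <= `|r| ->
      D (x + a *: delta_mx 0 i' + b *: delta_mx 0 j').
    rewrite [`|r|]gtr0_norm // => ar br.
    have /rP1[] // : `|x + a *: delta_mx 0 i' + b *: delta_mx 0 j' - x| < r1.
    by rewrite (lt_le_trans (near_pt a b i' j' ar br)) // ge_min lexx.
  have [t tr|c cr] := @MVT0 _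
     (fun t => f (x + r *: delta_mx 0 j + t *: delta_mx 0 i)
               - f (x + t *: delta_mx 0 i))
     (fun t => partial i f (x + r *: delta_mx 0 j + t *: delta_mx 0 i)
               - partial i f (x + t *: delta_mx 0 i)) r.
    apply: is_deriveB; apply: is_derive_line; apply: smooth_on_is_derive sf _.
      exact: inD.
    by rewrite -[x]addr0 -(scale0r (delta_mx 0 i)); apply: inD; rewrite ?normr0.
  rewrite scale0r !addr0 => ->.
  have [t tr|b br] := @MVT0 _
     (fun t => partial i f (x + c *: delta_mx 0 i + t *: delta_mx 0 j))
     (fun t => partial j (partial i f)
                 (x + c *: delta_mx 0 i + t *: delta_mx 0 j)) r.
    apply: is_derive_line; apply: smooth_on_is_derive (smooth_on_partial i sf) _.
    exact: inD.
  rewrite scale0r addr0 addrAC => ->.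
  exists (x + c *: delta_mx 0 i + b *: delta_mx 0 j) => //.
  by apply: near_pt; rewrite -(gtr0_norm r0).
have [y1 yr1 E1] := second l k; have [y2 yr2 E2] := second k l.
(* The second difference is symmetric in [k] and [l], so the two mixed derivatives agree at two
   possibly different points, both close to [x]; continuity then brings them back to [x]. *)
have E : partial k (partial l f) y1 = partial l (partial k f) y2.
  have swap (u v w z : R) : u - v - (w - z) = u - w - (v - z).
    by rewrite !opprB addrACA [- v + _]addrC -addrACA.
  have cancel (u v : R) : r * (r * u) = r * (r * v) -> v = u.
    by move=> /(mulfI (lt0r_neq0 r0))/(mulfI (lt0r_neq0 r0)).
  by move: E1; rewrite swap [x + r *: delta_mx 0 k + _]addrAC E2 => /cancel.
apply: (@ler_dist_half _ (partial k (partial l f) y1)).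
  by apply: (rP1 y1 _).2; apply: lt_le_trans yr1 _; rewrite ge_min lexx.
rewrite E.
by apply: (rP2 y2 _).2; apply: lt_le_trans yr2 _; rewrite ge_min lexx orbT.
Qed.

Lemma rV_differentiable n (phi : 'rV[R]_d -> 'rV[R]_n) x :
  (forall a, differentiable (fun y => phi y 0 a) x) -> differentiable phi x.
Proof.
move=> dphi.
have -> : phi = \sum_a (fun y => phi y 0 a *: delta_mx 0 a).
  by apply/funext => y; rewrite fct_sumE [LHS]matrix_sum_delta big_ord1.
by apply: differentiable_sum => a; exact: differentiableZl.
Qed.

Lemma jacobianE n (phi : 'rV[R]_d -> 'rV[R]_n) x k a : differentiable phi x ->
  jacobian phi x k a = partial k (fun y => phi y 0 a) x.
Proof.
move=> dphi; rewrite /partial.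
have -> : jacobian phi x k a = ((delta_mx 0 k : 'rV_d) *m jacobian phi x) 0 a.
  by rewrite -rowE [RHS]mxE.
rewrite -deriveEjacobian // derive_mx ?mxE //; exact: diff_derivable.
Qed.

End Calculus.

Lemma partial_comp (R : realType) (d n : nat) (phi : 'rV[R]_d -> 'rV[R]_n)
    (f : 'rV[R]_n -> R) x k : differentiable phi x ->
  differentiable f (phi x) ->
  partial k (f \o phi) x = \sum_a jacobian phi x k a * partial a f (phi x).
Proof.
move=> dphi df; rewrite partialE; last exact: differentiable_comp.
rewrite (diff_comp dphi df) /comp diff_rV_sum.
by apply: eq_bigr => a _; rewrite -partialE // /jacobian mxE.
Qed.

(** * Determinants and positive definite matrices *)

Lemma is_derive_prod (R : realType) (V : normedModType R) n
    (f : 'I_n -> V -> R) (df : 'I_n -> R) (x v : V) :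
  (forall k, is_derive x v (f k) (df k)) ->
  is_derive x v (fun y => \prod_k f k y)
    (\sum_k df k * \prod_(j | j != k) f j x).
Proof.
elim: n f df => [|n IH] f df fd.
  rewrite big_ord0.
  have -> : (fun y => \prod_k f k y) = cst 1.
    by apply/funext => y; rewrite big_ord0.
  exact: is_derive_cst.
have -> : (fun y => \prod_k f k y)
    = f ord0 * (fun y => \prod_k f (lift ord0 k) y).
  by apply/funext => y; rewrite big_ord_recl.
have IHf := IH (fun k => f (lift ord0 k)) (fun k => df (lift ord0 k))
               (fun k => fd (lift ord0 k)).
apply: is_derive_eq; rewrite big_ord_recl addrC /GRing.scale /=; congr (_ + _).
  rewrite mulrC; congr (_ * _).
  by rewrite [RHS]big_mkcond big_ord_recl /= mul1r.
rewrite mulr_sumr; apply: eq_bigr => k _; rewrite mulrCA; congr (_ * _).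
rewrite [RHS]big_mkcond big_ord_recl /=; congr (_ * _).
by rewrite [LHS]big_mkcond; apply: eq_bigr => j _; rewrite (inj_eq lift_inj).
Qed.

(** Jacobi's formula. The product rule in the Leibniz expansion differentiates one row at a time;
    [C k] has its row [k] taken from [dB], and expanding its determinant along that row yields the
    adjugate. *)
Lemma is_derive_det (R : realType) (V : normedModType R) n
    (B : V -> 'M[R]_n) (dB : 'M[R]_n) (x v : V) :
  (forall k l, is_derive x v (fun y => B y k l) (dB k l)) ->
  is_derive x v (fun y => \det (B y)) (\tr (dB *m \adj (B x))).
Proof.
move=> Bd.
pose C k : 'M[R]_n := \matrix_(i, j) if i == k then dB i j else B x i j.
have detC k : \det (C k) = \sum_l dB k l * cofactor (B x) k l.
  rewrite (expand_det_row _ k); apply: eq_bigr => l _; rewrite mxE eqxx.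
  congr (_ * (_ * \det _)); apply/matrixP => i j.
  by rewrite !mxE eq_sym (negbTE (neq_lift _ _)).
have -> : \tr (dB *m \adj (B x)) = \sum_k \det (C k).
  apply: eq_bigr => k _; rewrite detC mxE; apply: eq_bigr => l _.
  by rewrite [X in _ * X]mxE.
have -> : (fun y => \det (B y))
    = \sum_(s : 'S_n) (fun y => (-1) ^+ s * \prod_k B y k (s k)).
  by apply/funext => y; rewrite fct_sumE.
have step (s : 'S_n) : is_derive x v (fun y => (-1) ^+ s * \prod_k B y k (s k))
   (\sum_k (-1) ^+ s * \prod_i C k i (s i)).
  have D := is_derive_prod (fun k => Bd k (s k)).
  have -> : (fun y => (-1) ^+ s * \prod_k B y k (s k))
    = (-1) ^+ s *: (fun y => \prod_k B y k (s k)) by [].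
  apply: is_derive_eq; rewrite /GRing.scale /= mulr_sumr.
  apply: eq_bigr => k _; rewrite [in RHS](bigD1 k) //= mxE eqxx.
  congr (_ * (_ * _)); apply: eq_bigr => i ik; rewrite mxE (negbTE ik) //.
rewrite exchange_big /=.
elim/big_ind2 : _ => [|f df g dg fd gd|s _]; last exact: step.
  exact: is_derive_cst.
exact: is_deriveD.
Qed.

(** The space [V] is kept general because the formula serves twice: for a line in the space of
    metrics, and for one metric in a chart moved along a vector field. *)
Lemma is_derive_sqrt_det (R : realType) (V : normedModType R) n
    (B : V -> 'M[R]_n) (dB : 'M[R]_n) (x v : V) : 0 < \det (B x) ->
  (forall k l, is_derive x v (fun y => B y k l) (dB k l)) ->
  is_derive x v (fun y => Num.sqrt (\det (B y)))
    (\tr (invmx (B x) *m dB) / 2 * Num.sqrt (\det (B x))).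
Proof.
move=> B0 Bd; have s0 : Num.sqrt (\det (B x)) != 0 by rewrite gt_eqF ?sqrtr_gt0.
have := is_derive_comp1 (is_derive_det Bd) (is_derive1_sqrt B0).
congr is_derive.
have -> : \adj (B x) = \det (B x) *: invmx (B x).
  by rewrite /invmx unitmxE unitfE gt_eqF // scalerA mulfV ?scale1r ?gt_eqF.
rewrite -scalemxAr mxtraceZ mxtrace_mulC -[in X in _ * (X * _)](sqr_sqrtr (ltW B0)).
by field.
Qed.

Section PositiveDefinite.
Variable R : realType.

(** Elimination of the first coordinate yields a factorization without eigenvalues; the induction
    runs on the Schur complement. *)
Lemma cholesky n (B : 'M[R]_n) : B^T = B ->
  (forall u, u != 0 -> 0 < quad B u) -> exists P : 'M[R]_n, B = P *m P^T.
Proof.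
elim: n B => [|n IH] B; first by exists 0; apply/matrixP => -[].
rewrite -[n.+1]/(1 + n)%N in B * => Bsym Bpos.
pose a : 'M[R]_1 := ulsubmx B; pose b := ursubmx B; pose C := drsubmx B.
have blockB : B = block_mx a b b^T C.
  by rewrite -[LHS]submxK /a /b /C trmx_ursub Bsym.
have quadB (s : 'M[R]_1) (u : 'rV[R]_n) : quad B (row_mx s u)
    = (s *m a *m s^T + u *m b^T *m s^T + s *m b *m u^T + u *m C *m u^T) 0 0.
  rewrite /quad blockB mul_row_block tr_row_mx mul_row_col !mulmxDl addrA.
  by [].
pose al := a 0 0; have aE : a = al%:M by exact: mx11_scalar.
have al0 : 0 < al.
  have : row_mx 1%:M (0 : 'rV[R]_n) != 0 :> 'rV[R]_(1 + n).
    by rewrite row_mx_eq0 negb_and (matrix_nonzero1 _).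
  move=> /Bpos; rewrite quadB !mul0mx trmx0 !mulmx0 !addr0 mul1mx trmx1 mulmx1.
  by [].
pose C' := C - al^-1 *: (b^T *m b).
have [|u u0|Q QE] := IH C'.
- rewrite /C' linearB linearZ /= trmx_mul trmxK; congr (_ - _).
  by rewrite /C trmx_drsub Bsym.
(* For fixed [u], this first coordinate minimizes the quadratic form of [B], and the minimum is the
   value of the Schur complement at [u]. *)
- have : row_mx (- al^-1 *: (u *m b^T)) u != 0.
    by rewrite row_mx_eq0 negb_and u0 orbT.
  move=> /Bpos; rewrite quadB /quad /C'; congr (0 < _).
  rewrite mulmxBr mulmxBl; move: (u *m C *m u^T) => E.
  rewrite -scalemxAr -scalemxAl mulmxA.
  have -> : (- al^-1 *: (u *m b^T))^T = - al^-1 *: (b *m u^T).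
    by rewrite linearZ /= trmx_mul trmxK.
  rewrite aE mul_mx_scalar -!scalemxAl -!scalemxAr !mulmxA !scalerA.
  move: (u *m b^T *m b *m u^T) => F; rewrite !mxE.
  by field; rewrite gt_eqF.
pose sq := Num.sqrt al; have sq0 : sq != 0 by rewrite gt_eqF ?sqrtr_gt0.
have sqal : sq * sq = al by rewrite -expr2 sqr_sqrtr // ltW.
exists (block_mx sq%:M 0 (sq^-1 *: b^T) Q).
rewrite tr_block_mx mulmx_block blockB trmx0 !mul0mx !mulmx0 !addr0.
rewrite linearZ /= trmxK tr_scalar_mx -scalar_mxM sqal -aE.
rewrite mul_scalar_mx mul_mx_scalar !scalerA mulfV // !scale1r.
rewrite -scalemxAl -scalemxAr scalerA -invfM sqal -QE /C' addrC subrK.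
by [].
Qed.

Section Metric.
Variables (n : nat) (B : 'M[R]_n).
Hypothesis Bsym : B^T = B.
Hypothesis Bpos : forall u, u != 0 -> 0 < quad B u.

Lemma posdef_det_gt0 : 0 < \det B.
Proof.
have [P BE] := cholesky Bsym Bpos.
rewrite lt_def; apply/andP; split; last first.
  by rewrite BE det_mulmx det_tr -expr2 sqr_ge0.
apply/det0P => -[u u0 uB]; have := Bpos u0.
by rewrite /quad uB mul0mx mxE ltxx.
Qed.

Lemma posdef_unitmx : B \in unitmx.
Proof. by rewrite unitmxE unitfE gt_eqF // posdef_det_gt0. Qed.

(* With B = P P^T, the endomorphism B^-1 h is conjugate to the symmetric
   matrix P^-1 h P^-T, to which Cauchy-Schwarz applies. *)
Lemma sqr_trace_le (h : 'M[R]_n) : h^T = h ->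
  \tr (invmx B *m h) ^+ 2 <=
    n%:R * \tr (invmx B *m h *m invmx B *m h).
Proof.
move=> hsym; have [P BE] := cholesky Bsym Bpos.
have Pu : P \in unitmx by have := posdef_unitmx; rewrite BE unitmx_mul => /andP[].
pose Q := invmx P.
have invE : invmx B = Q^T *m Q.
  apply: (can_inj (mulmxK posdef_unitmx)); rewrite mulVmx ?posdef_unitmx //.
  rewrite [in RHS]BE /Q trmx_inv -mulmxA (mulmxA (invmx P)) mulVmx // mul1mx.
  by rewrite mulVmx // unitmx_tr.
pose S := Q *m h *m Q^T.
have Ssym i j : S i j = S j i.
  have ST : S^T = S by rewrite /S !trmx_mul trmxK hsym mulmxA.
  by rewrite -[in LHS]ST mxE.
have -> : \tr (invmx B *m h) = \tr S.
  by rewrite invE /S -mulmxA mxtrace_mulC.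
have -> : \tr (invmx B *m h *m invmx B *m h) = \sum_i \sum_j S i j ^+ 2.
  have -> : \tr (invmx B *m h *m invmx B *m h) = \tr (S *m S).
    by rewrite invE /S -!mulmxA mxtrace_mulC -!mulmxA.
  apply: eq_bigr => i _; rewrite mxE; apply: eq_bigr => j _.
  by rewrite expr2 [in X in _ * X]Ssym.
(* Off-diagonal squares are discarded, leaving Cauchy-Schwarz for the diagonal of [S] against the
   all-ones vector. *)
apply: (@le_trans _ _ (n%:R * \sum_i S i i ^+ 2)); last first.
  apply: ler_wpM2l => //; apply: ler_sum => i _.
  by rewrite (bigD1 i) //= lerDl; apply: sumr_ge0 => j _; exact: sqr_ge0.
rewrite /mxtrace -subr_ge0 -(@pmulr_rge0 _ 2) //.
(* Lagrange's identity; the factor 2 is there because the double sum counts each pair twice. *)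
have -> : 2 * (n%:R * (\sum_i S i i ^+ 2) - (\sum_i S i i) ^+ 2)
    = \sum_i \sum_j (S i i - S j j) ^+ 2.
  transitivity (\sum_i (n%:R * S i i ^+ 2 - 2 * S i i * (\sum_j S j j)
      + \sum_j S j j ^+ 2)).
    rewrite big_split sumrB /= -mulr_sumr -mulr_suml -mulr_sumr sumr_const.
    by rewrite card_ord -[_ *+ n]mulr_natl; ring.
  apply: eq_bigr => i _; rewrite mulr_sumr.
  have -> : n%:R * S i i ^+ 2 = \sum_(j < n) S i i ^+ 2.
    by rewrite sumr_const card_ord mulr_natl.
  rewrite -sumrB -big_split /=.
  by apply: eq_bigr => j _; ring.
by do 2!apply: sumr_ge0 => ? _; exact: sqr_ge0.
Qed.

End Metric.
End PositiveDefinite.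

Lemma sqrt_det_congr (R : realType) n (J B : 'M[R]_n) :
  Num.sqrt (\det (J *m B *m J^T)) = Num.sqrt (\det B) * `|\det J|.
Proof.
rewrite !det_mulmx det_tr mulrC mulrA -expr2 sqrtrM ?sqr_ge0 // sqrtr_sqr.
by rewrite mulrC.
Qed.

(** Under a change of chart the endomorphism [B^-1 h] is conjugated by [J^T], which preserves its
    trace. *)
Lemma trace_congr (R : fieldType) n (J B h : 'M[R]_n) :
  J *m B *m J^T \in unitmx ->
  \tr (invmx (J *m B *m J^T) *m (J *m h *m J^T)) = \tr (invmx B *m h).
Proof.
move=> U; have := U; rewrite !unitmx_mul unitmx_tr => /andP[/andP[Ju Bu] _].
set X := invmx _.
have -> : invmx B = J^T *m X *m J; last first.
  by rewrite mulmxA mxtrace_mulC !mulmxA.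
apply: (can_inj (mulmxK Bu)); rewrite mulVmx //.
apply: (can_inj (mulmxK (_ : J^T \in unitmx))); first by rewrite unitmx_tr.
by rewrite mul1mx -!mulmxA (mulmxA J) mulVmx // mulmx1.
Qed.

(** * Integrals *)

Section Integral.
Import HBNNSimple.

(* No measurability is needed: the integral of a nonnegative function is a
   supremum over the simple functions below it. *)
Lemma ge0_integral_scale_le dT (T : measurableType dT) (R : realType)
    (mu : {measure set T -> \bar R}) (f g : T -> \bar R) (k : R) : 0 < k ->
  (forall x, 0 <= f x)%E -> (forall x, k%:E * f x <= g x)%E ->
  (k%:E * (\int[mu]_x f x) <= \int[mu]_x g x)%E.
Proof.
move=> k0 f0 fg.
have g0 x : (0 <= g x)%E.
  by apply: le_trans (fg x); rewrite mule_ge0 // lee_fin ltW.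
rewrite !ge0_integralTE // -lee_pdivlMl //.
apply: ge_ereal_sup => _ [h /= hf <-].
rewrite lee_pdivlMl // -sintegralrM.
apply: ereal_sup_ubound; exists (scale_nnsfun h (ltW k0)) => //= x.
by apply: le_trans (fg x); rewrite EFinM lee_pmul2l.
Qed.

End Integral.

Lemma integral_rV_ge0 (R : realType) d (f : 'rV[R]_d -> \bar R) :
  (forall x, 0 <= f x)%E -> (0 <= integral_rV f)%E.
Proof.
elim: d f => [|d IH] f f0 /=; first exact: f0.
by apply: integral_ge0 => t _; apply: IH => x; exact: f0.
Qed.

Lemma integral_rV_scale_le (R : realType) d (f g : 'rV[R]_d -> \bar R) (k : R) :
  0 < k -> (forall x, 0 <= f x)%E -> (forall x, k%:E * f x <= g x)%E ->
  (k%:E * integral_rV f <= integral_rV g)%E.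
Proof.
move=> k0; elim: d f g => [|d IH] f g f0 fg /=; first exact: fg.
apply: ge0_integral_scale_le => // t; last exact: IH.
exact: integral_rV_ge0.
Qed.

(** Monotonicity and scaling in a single inequality. It is applied with [k = 4 / d] for one bound
    between the metrics and with [k = d / 4] for the other. *)
Lemma density_integral_scale_le (R : realType) d (M : topologicalType)
    (A : atlas R d M) (chi : partition_of_unity A) (mu nu : A -> M -> R) (k : R) :
  0 < k -> (forall i p, dom i p -> 0 <= mu i p) ->
  (forall i p, dom i p -> k * mu i p <= nu i p) ->
  (k%:E * density_integral chi mu <= density_integral chi nu)%E.
Proof.
move=> k0 mu0 munu; rewrite /density_integral /=.
rewrite ge0_sume_distrr => [|j _].
  apply: lee_sum => j _; apply: integral_rV_scale_le => // x; case: ifP => //;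
    last by rewrite mule0.
    rewrite inE => /param_dom xi; rewrite lee_fin mulr_ge0 ?pou_ge0 //.
    exact: mu0.
  rewrite inE => /param_dom xi; rewrite -EFinM lee_fin mulrCA.
  by rewrite ler_wpM2l ?pou_ge0 // munu.
apply: integral_rV_ge0 => x; case: ifP => //.
by rewrite inE => /param_dom xi; rewrite lee_fin mulr_ge0 ?pou_ge0 // mu0.
Qed.

(** * Change of charts *)

(* [vector] has shadowed the [coord] of the atlas. *)
Import Defs.

Section MatrixDerivatives.
Variables (R : realType) (V : normedModType R).

Definition mx_is_derive m n (B : V -> 'M[R]_(m, n))
    (x v : V) (dB : 'M[R]_(m, n)) :=
  forall k l, is_derive x v (fun y => B y k l) (dB k l).

Lemma mx_is_derive_mulmx m n p (B : V -> 'M[R]_(m, n)) (C : V -> 'M[R]_(n, p))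
    x v dB dC : mx_is_derive B x v dB -> mx_is_derive C x v dC ->
  mx_is_derive (fun y => B y *m C y) x v (dB *m C x + B x *m dC).
Proof.
move=> Bd Cd k l.
have -> : (fun y => (B y *m C y) k l)
    = \sum_j ((fun y => B y k j) * (fun y => C y j l)).
  by apply/funext => y; rewrite mxE fct_sumE.
have Dj j : is_derive x v ((fun y => B y k j) * (fun y => C y j l))
    (B x k j *: dC j l + C x j l *: dB k j) by exact: is_deriveM.
apply: is_derive_eq; rewrite !mxE -big_split /=; apply: eq_bigr => j _.
by rewrite addrC; congr (_ + _); exact: mulrC.
Qed.

Lemma mx_is_derive_tr m n (B : V -> 'M[R]_(m, n)) x v dB :
  mx_is_derive B x v dB -> mx_is_derive (fun y => (B y)^T) x v dB^T.
Proof.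
move=> Bd k l; rewrite mxE; have := Bd l k; congr is_derive.
by apply/funext => y; rewrite mxE.
Qed.

End MatrixDerivatives.

Lemma differentiable_is_derive (R : realType) d (f : 'rV[R]_d -> R) x v :
  differentiable f x -> is_derive x v f (\sum_m v 0 m * partial m f x).
Proof.
move=> df; apply: DeriveDef; first exact: diff_derivable.
rewrite deriveE // diff_rV_sum; apply: eq_bigr => m _.
by rewrite partialE.
Qed.

(** * Transition maps and the tensor law of the Lie derivative of a metric *)

Section Atlas.
Variables (R : realType) (d : nat) (M : topologicalType) (A : atlas R d M).
Implicit Types (i j : A) (p : M) (F : M -> R).

Definition overlap i j : set 'rV[R]_d := img i `&` param i @^-1` dom j.

Lemma open_overlap i j : open (overlap i j).
Proof.
rewrite openE => x [xi xj]; rewrite /interior; apply: filterI.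
  by apply: open_nbhs_nbhs; split=> //; exact: img_open.
apply: (param_continuous xi); apply: open_nbhs_nbhs; split=> //.
exact: dom_open.
Qed.

Lemma coord_overlap i j p : dom i p -> dom j p -> overlap i j (coord i p).
Proof.
by move=> ip jp; split; [exact: coord_img | rewrite /= coordK].
Qed.

Lemma transition_differentiable i j x : overlap i j x ->
  differentiable (coord j \o param i) x.
Proof.
move=> xO; apply: rV_differentiable => a.
apply: (@smooth_on_differentiable _ _ _
  (fun y => coord j (param i y) 0 a) _ (@open_overlap i j) _ xO).
exact: (@transition_smooth _ _ _ A).
Qed.

(** The Jacobian of the transition map as a function on the chart, with entries that can be
    differentiated once more. *)
Definition transition_mx i j (x : 'rV[R]_d) : 'M[R]_d :=
  \matrix_(k, a) partial k (fun y => coord j (param i y) 0 a) x.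

Lemma JacE i j x : overlap i j x -> Jac i j (param i x) = transition_mx i j x.
Proof.
move=> xO; apply/matrixP => k a; rewrite /Jac paramK; last by case: xO.
rewrite jacobianE; last exact: transition_differentiable.
by rewrite [RHS]mxE.
Qed.

Lemma Jac_coordE i j p : dom i p -> dom j p ->
  Jac i j p = transition_mx i j (coord i p).
Proof.
by move=> ip jp; rewrite -JacE ?coordK //; exact: coord_overlap.
Qed.

(** [F] will be a component taken in chart [j], which vanishes outside [dom j], so smoothness is
    asked in chart [j] only. Near the point, [F] read in chart [i] is the composite of [F] read in
    chart [j] with the transition map. *)
Lemma is_derive_change_chart i j p F v : dom i p -> dom j p ->
  smooth_on (img j) (F \o param j) ->
  is_derive (coord i p) v (F \o param i)
    (\sum_a (v *m Jac i j p) 0 a * partial a (F \o param j) (coord j p)).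
Proof.
move=> ip jp sF; have pO := coord_overlap ip jp.
have dphi := transition_differentiable pO.
have xE : (coord j \o param i) (coord i p) = coord j p by rewrite /= coordK.
have dF : differentiable (F \o param j) ((coord j \o param i) (coord i p)).
  rewrite xE; apply: (smooth_on_differentiable (@img_open _ _ _ _ j) sF).
  exact: coord_img.
apply: (near_eq_is_derive (f := (F \o param j) \o (coord j \o param i))).
  apply: (near_eq_on (@open_overlap i j) pO) => y [yi yj] /=.
  by rewrite coordK.
have dc := differentiable_comp dphi dF.
apply: is_derive_eq; first exact: (differentiable_is_derive v dc).
under eq_bigr => m _ do rewrite (partial_comp m dphi dF) mulr_sumr.
rewrite exchange_big /=; apply: eq_bigr => a _; rewrite [in RHS]mxE mulr_suml -xE.
by apply: eq_bigr => m _; rewrite mulrA.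
Qed.



Definition lie_dir (v : A -> M -> 'rV[R]_d) (g : A -> M -> 'M[R]_d) i p : 'M[R]_d :=
  \matrix_(k, l) \sum_m
    v i p 0 m * partial m (fun x => g i (param i x) k l) (coord i p).

Definition vector_jac (v : A -> M -> 'rV[R]_d) i p : 'M[R]_d :=
  \matrix_(k, m) partial k (fun x => v i (param i x) 0 m) (coord i p).

Lemma lie_metricE (v : A -> M -> 'rV[R]_d) (g : A -> M -> 'M[R]_d) i p :
  lie_metric v g i p = lie_dir v g i p + vector_jac v i p *m g i p
                       + g i p *m (vector_jac v i p)^T.
Proof.
apply/matrixP => k l; rewrite !mxE -!big_split /=; apply: eq_bigr => m _.
by rewrite !mxE [partial k _ _ * _]mulrC.
Qed.

Section LieTensor.
Variables (v : A -> M -> 'rV[R]_d) (g : A -> M -> 'M[R]_d).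
Hypotheses (vF : vector_fields v) (gF : sym2_fields g).
Variables (i j : A) (p : M).
Hypotheses (ip : dom i p) (jp : dom j p).
Let x := coord i p.
Let xO : overlap i j x := coord_overlap ip jp.
Let J := Jac i j p.

(** The derivative of the Jacobian [J] along [v]: the defect by which the separate parts of the Lie
    derivative fail to be tensors. *)
Let H : 'M[R]_d := \matrix_(k, a) \sum_m v i p 0 m *
  partial m (partial k (fun y => coord j (param i y) 0 a)) x.

Let transition_smooth' a :
  smooth_on (overlap i j) (fun y => coord j (param i y) 0 a).
Proof. exact: (@transition_smooth _ _ _ A). Qed.

Let transition_mx_derive (w : 'rV[R]_d) :
  mx_is_derive (transition_mx i j) x w (\matrix_(k, a) \sum_m w 0 m *
    partial m (partial k (fun y => coord j (param i y) 0 a)) x).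
Proof.
move=> k a; rewrite mxE.
have sk := smooth_on_partial k (@transition_smooth' a).
have -> : (fun y => transition_mx i j y k a)
    = partial k (fun y => coord j (param i y) 0 a).
  by apply/funext => y; rewrite mxE.
apply: differentiable_is_derive.
exact: smooth_on_differentiable (@open_overlap i j) sk xO.
Qed.

(** Product rule along [v] applied to [g_i = J g_j J^T]; differentiating the two outer factors
    produces the terms in [H]. *)
Lemma lie_dir_transform : lie_dir v g i p = H *m g j p *m J^T
  + J *m lie_dir v g j p *m J^T + J *m g j p *m H^T.
Proof.
have [_ gs _ gT] := gF; have [_ vs vT] := vF.
have Jx : transition_mx i j x = J by rewrite /J Jac_coordE.
have gD : mx_is_derive (fun y => g j (param i y)) x (v i p) (lie_dir v g j p).
  move=> a b; rewrite mxE (vT i j p ip jp).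
  exact: (@is_derive_change_chart i j p (fun q => g j q a b) _ ip jp (gs j a b)).
have HD := transition_mx_derive (v i p).
have := mx_is_derive_mulmx (mx_is_derive_mulmx HD gD) (mx_is_derive_tr HD).
rewrite -/H Jx /x coordK // => D; apply/matrixP => k l.
have gi : differentiable (fun y => g i (param i y) k l) x.
  apply: smooth_on_differentiable (gs i k l) _; [exact: img_open|].
  exact: coord_img.
have [_ E1] := differentiable_is_derive (v i p) gi.
rewrite mxE -E1; have [_ E2] := D k l.
rewrite mulmxDl in E2; rewrite -E2; apply: near_eq_derive.
apply: (near_eq_on (@open_overlap i j) xO) => y yO; have [yi yj] := yO.
by rewrite (gT i j) ?JacE //; exact: param_dom.
Qed.

(** Obtained by differentiating [v_j = v_i J]. The resulting defect [H] matches the one in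
    [lie_dir_transform], so the two cancel in the full Lie derivative. *)
Lemma vector_jac_transform : vector_jac v i p *m J + H = J *m vector_jac v j p.
Proof.
have [_ vs vT] := vF.
have Jx : transition_mx i j x = J by rewrite /J Jac_coordE.
apply/matrixP => k c; pose e : 'rV[R]_d := delta_mx 0 k.
have [_ E1] := @is_derive_change_chart i j p (fun q => v j q 0 c) e ip jp (vs j c).
have vD : mx_is_derive (fun y => v i (param i y)) x e
    (\row_m partial k (fun y => v i (param i y) 0 m) x).
  move=> o m; rewrite ord1 mxE.
  by apply: smooth_on_is_derive (vs i m) _; exact: coord_img.
have [_ E2] := mx_is_derive_mulmx vD (transition_mx_derive e) 0 c.
have E : 'D_e (fun y => v j (param i y) 0 c) x
    = 'D_e (fun y => (v i (param i y) *m transition_mx i j y) 0 c) x.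
  apply: near_eq_derive; apply: (near_eq_on (@open_overlap i j) xO) => y yO.
  by have [yi yj] := yO; rewrite (vT i j) ?JacE //; exact: param_dom.
move: E; rewrite E2; rewrite [LHS]E1 => E.
have -> : (J *m vector_jac v j p) k c = \sum_a (e *m J) 0 a *
    partial a ((fun q => v j q 0 c) \o param j) (coord j p).
  by rewrite mxE; apply: eq_bigr => a _; rewrite -rowE !mxE.
rewrite E Jx /x coordK // !mxE; congr (_ + _).
  by apply: eq_bigr => m _; rewrite !mxE.
apply: eq_bigr => m _; rewrite mxE; congr (_ * _).
(* The product rule gives the derivative in direction [k] of column [c] of [J], contracted with [v];
   exchanging the two derivatives turns it into [H]. *)
rewrite (smooth_on_partialC m k (@open_overlap i j) (@transition_smooth' c) xO).
rewrite (bigD1 k) //= big1 => [|l lk]; last first.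
  by rewrite mxE (negbTE lk) andbF mul0r.
by rewrite mxE !eqxx mul1r addr0.
Qed.

Lemma lie_metric_transform :
  lie_metric v g i p = J *m lie_metric v g j p *m J^T.
Proof.
have [_ _ _ gT] := gF.
rewrite !lie_metricE lie_dir_transform (gT i j p ip jp) -/J.
rewrite !mulmxDr !mulmxDl.
have -> : J *m (vector_jac v j p *m g j p) *m J^T
    = vector_jac v i p *m (J *m g j p *m J^T) + H *m g j p *m J^T.
  by rewrite mulmxA -vector_jac_transform !mulmxDl !mulmxA.
have -> : J *m (g j p *m (vector_jac v j p)^T) *m J^T
    = J *m g j p *m J^T *m (vector_jac v i p)^T + J *m g j p *m H^T.
  rewrite -!mulmxA -trmx_mul -vector_jac_transform linearD /= trmx_mul.
  by rewrite !mulmxDr !mulmxA.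
move: (H *m _ *m _) (J *m lie_dir _ _ _ _ *m _) (J *m _ *m H^T) => a b c.
move: (vector_jac v i p *m _) (_ *m (vector_jac v i p)^T) => e f.
by rewrite [e + a]addrC [f + c]addrC !addrA [b + a]addrC [in RHS](addrAC _ e c).
Qed.

End LieTensor.

End Atlas.

(** * Metrics and densities *)

Section MetricsDensities.
Variables (R : realType) (d : nat) (M : topologicalType) (A : atlas R d M).
Implicit Types (i j : A) (p : M) (c f : M -> R) (g h : A -> M -> 'M[R]_d).
Implicit Types (rho mu : A -> M -> R) (v : A -> M -> 'rV[R]_d).

Let oimg i : open (img i). Proof. exact: img_open. Qed.

Lemma sym2_fieldsD g h : sym2_fields g -> sym2_fields h ->
  sym2_fields (fun i p => g i p + h i p).
Proof.
move=> [g0 gs gT gJ] [h0 hs hT hJ]; split.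
- by move=> i p ip; rewrite g0 ?h0 ?addr0.
- move=> i k l; apply: (smooth_on_eq (@oimg i) _
    (smooth_onD (@oimg i) (gs i k l) (hs i k l))) => x _.
  by rewrite mxE.
- by move=> i p; rewrite linearD /= gT hT.
- by move=> i j p ip jp; rewrite (gJ i j) ?(hJ i j) // mulmxDr mulmxDl.
Qed.

Lemma sym2_fieldsZ c g : smooth_fun A c -> sym2_fields g ->
  sym2_fields (fun i p => c p *: g i p).
Proof.
move=> sc [g0 gs gT gJ]; split.
- by move=> i p ip; rewrite g0 ?scaler0.
- move=> i k l; apply: (smooth_on_eq (@oimg i) _
    (smooth_onM (@oimg i) (sc i) (gs i k l))) => x _.
  by rewrite mxE.
- by move=> i p; rewrite linearZ /= gT.
- by move=> i j p ip jp; rewrite (gJ i j) // -scalemxAr -scalemxAl.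
Qed.

Lemma smooth_fun_cst (a : R) : smooth_fun A (fun=> a).
Proof. by move=> i; exact: smooth_on_cst. Qed.

Lemma smooth_funM c f : smooth_fun A c -> smooth_fun A f ->
  smooth_fun A (fun p => c p * f p).
Proof. by move=> sc sf i; exact: (smooth_onM (@oimg i) (sc i) (sf i)). Qed.

Lemma metricsZ c g : smooth_fun A c -> (forall p, 0 < c p) -> metrics g ->
  metrics (fun i p => c p *: g i p).
Proof.
move=> sc c0 [gS gP]; split; first exact: sym2_fieldsZ.
move=> i p ip u u0; rewrite /quad -scalemxAr -scalemxAl mxE mulr_gt0 //.
exact: gP.
Qed.

(** Extension by zero makes [lie_metric] obey the convention for fields outside the chart domain. *)
Definition lie_field v g : A -> M -> 'M[R]_d :=
  fun i => patch (fun=> 0) (dom i) (lie_metric v g i).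

Lemma lie_fieldE v g i p : dom i p -> lie_field v g i p = lie_metric v g i p.
Proof. by move=> ip; rewrite /lie_field patchT // inE. Qed.

Lemma lie_field_sym2 v g : vector_fields v -> sym2_fields g ->
  sym2_fields (lie_field v g).
Proof.
move=> vF gF; have [g0 gs gT gJ] := gF; have [v0 vs vT] := vF.
split.
- by move=> i p ip; rewrite /lie_field patchC // inE.
- move=> i k l; apply: (smooth_on_eq (@oimg i) (f := fun x => \sum_m
    (v i (param i x) 0 m * partial m (fun x => g i (param i x) k l) x
     + g i (param i x) m l * partial k (fun x => v i (param i x) 0 m) x
     + g i (param i x) k m * partial l (fun x => v i (param i x) 0 m) x))).
    move=> x xi; rewrite lie_fieldE ?mxE; last exact: param_dom.
    by rewrite paramK.
  apply: (smooth_on_sum (@oimg i)) => m _.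
  apply: (smooth_onD (@oimg i)); [apply: (smooth_onD (@oimg i))|];
    apply: (smooth_onM (@oimg i)).
  - exact: vs.
  - exact/smooth_on_partial/gs.
  - exact: gs.
  - exact/smooth_on_partial/vs.
  - exact: gs.
  - exact/smooth_on_partial/vs.
- move=> i p; have [ip|ip] := EM (dom i p); last first.
    by rewrite /lie_field patchC ?inE // trmx0.
  rewrite lie_fieldE //; apply/matrixP => k l; rewrite !mxE.
  have gsym q a b : g i q a b = g i q b a by rewrite -[in LHS](gT i q) mxE.
  have fsym : (fun x => g i (param i x) l k) = (fun x => g i (param i x) k l).
    by apply/funext => y; exact: gsym.
  apply: eq_bigr => m _.
  by rewrite fsym (gsym p l m) (gsym p m k) addrAC.
- move=> i j p ip jp; rewrite !lie_fieldE //; exact: lie_metric_transform.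
Qed.

(** * The volume density and its derivative *)

Section Volume.
Variable g : A -> M -> 'M[R]_d.
Hypothesis gM : metrics g.

Lemma metric_det_gt0 i p : dom i p -> 0 < \det (g i p).
Proof.
have [[_ _ gT _] gP] := gM => ip.
by apply: posdef_det_gt0; [exact: gT | exact: gP].
Qed.

Lemma metric_unitmx i p : dom i p -> g i p \in unitmx.
Proof. by move=> ip; rewrite unitmxE unitfE gt_eqF // metric_det_gt0. Qed.

Lemma vol_gt0 i p : dom i p -> 0 < vol g i p.
Proof. by move=> ip; rewrite sqrtr_gt0 metric_det_gt0. Qed.

Lemma vol_smooth i : smooth_on (img i) (vol g i \o param i).
Proof.
have [[_ gs _ _] _] := gM; apply: smooth_on_sqrt => //.
  by move=> x xi; apply: metric_det_gt0; exact: param_dom.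
by apply: smooth_on_det => // k l; exact: gs.
Qed.

Lemma vol_densities : (0 < d)%N -> densities (vol g).
Proof.
move=> d0; have [[g0 gs gT gJ] _] := gM; split; last by move=> i p; exact: vol_gt0.
split.
(* Outside the chart the metric is the zero matrix, whose determinant vanishes because [d] is
   positive; for [d = 0] it would be 1. *)
- move=> i p ip; rewrite /vol g0 // -(scale0r 1%:M) detZ expr0n eqn0Ngt d0.
  by rewrite mul0r sqrtr0.
- exact: vol_smooth.
- by move=> i j p ip jp; rewrite /vol (gJ i j p ip jp) sqrt_det_congr.
Qed.

Lemma is_derive_vol h i p : dom i p ->
  is_derive (0 : R) 1 (fun t : R => vol (g + t *: h) i p)
    (\tr (invmx (g i p) *m h i p) / 2 * vol g i p).
Proof.
move=> ip.
have := @is_derive_sqrt_det _ R^o _ (fun t : R => g i p + t *: h i p) (h i p) 0 1.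
rewrite scale0r addr0; apply; first exact: metric_det_gt0.
move=> k l; have -> : (fun t : R => (g i p + t *: h i p) k l)
    = cst (g i p k l) + (fun t : R => t * h i p k l).
  by apply/funext => t; rewrite !mxE.
apply: is_derive_eq.
by rewrite scaler0 !add0r; exact: mulr1.
Qed.

Lemma tangent_volE h i p : dom i p -> tangent_map (@vol R d M A) g h i p =
  \tr (invmx (g i p) *m h i p) / 2 * vol g i p.
Proof.
by move=> ip; rewrite /tangent_map derive1E; have [_ ->] := is_derive_vol h ip.
Qed.

Lemma tangent_vol_out h i p : sym2_fields h -> ~ dom i p ->
  (fun t : R => vol (g + t *: h) i p) = cst (Num.sqrt (\det (0 : 'M[R]_d))).
Proof.
move=> [h0 _ _ _] ip; have [[g0 _ _ _] _] := gM.
apply/funext => t; rewrite /vol.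
have -> : (g + t *: h) i p = g i p + t *: h i p by [].
by rewrite g0 ?h0 // scaler0 addr0.
Qed.

Lemma tangent_vol_density h : sym2_fields h ->
  density_fields (tangent_map (@vol R d M A) g h).
Proof.
move=> hF; have [h0 hs hT hJ] := hF; have [[g0 gs gT gJ] _] := gM; split.
- move=> i p ip; rewrite /tangent_map tangent_vol_out //.
  by rewrite derive1E derive_cst.
- move=> i; apply: (smooth_on_eq (@oimg i) (f := fun x =>
      \tr (invmx (g i (param i x)) *m h i (param i x)) * 2^-1
      * vol g i (param i x))).
    by move=> x /param_dom xi /=; rewrite tangent_volE.
  apply: smooth_onM; [exact: oimg| | exact: vol_smooth].
  apply: smooth_onM; [exact: oimg| | exact: smooth_on_cst].
  apply: smooth_on_sum; [exact: oimg|] => k _.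
  apply: smooth_on_mulmx => // a b.
  apply: smooth_on_invmx => // x /param_dom; exact: metric_det_gt0.
- move=> i j p ip jp; rewrite !tangent_volE // -[RHS]mulrA; congr (_ / 2 * _).
    have gi := metric_unitmx ip; rewrite (gJ i j p ip jp) in gi *.
    by rewrite (hJ i j p ip jp) trace_congr.
  by rewrite /vol (gJ i j p ip jp) sqrt_det_congr.
Qed.

(** Both sides are the derivative of [vol g] along [v] plus [vol g] times the trace of the
    derivative of [v]. On the left that trace occurs twice, from the two slots of the metric, and is
    halved. *)
Lemma tangent_vol_lie v i p : vector_fields v -> dom i p ->
  \tr (invmx (g i p) *m lie_metric v g i p) / 2 * vol g i p
    = lie_density v (vol g) i p.
Proof.
move=> [_ vs _] ip; have [[_ gs gT _] _] := gM.
have xi : img i (coord i p) by exact: coord_img.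
have gD : mx_is_derive (fun y => g i (param i y)) (coord i p) (v i p)
    (lie_dir v g i p).
  move=> k l; rewrite mxE; apply: differentiable_is_derive.
  exact: smooth_on_differentiable (gs i k l) xi.
have g0 : 0 < \det (g i (param i (coord i p))).
  by rewrite coordK //; exact: metric_det_gt0.
have [_ E1] := is_derive_sqrt_det g0 gD.
have dv : differentiable (vol g i \o param i) (coord i p).
  exact: smooth_on_differentiable (@vol_smooth i) xi.
have [_ E2] := differentiable_is_derive (v i p) dv.
have -> : lie_density v (vol g) i p
    = 'D_(v i p) (vol g i \o param i) (coord i p)
      + vol g i p * \tr (vector_jac v i p).
  rewrite E2 /lie_density /mxtrace mulr_sumr -big_split /=.
  apply: eq_bigr => m _; rewrite mxE /partial deriveM; last 2 first.
  - exact: smooth_on_derivable (@vol_smooth i) xi.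
  - exact: smooth_on_derivable (vs i m) xi.
  by rewrite coordK // addrC.
rewrite E1 coordK // lie_metricE !mulmxDr !linearD /= -/(vol g i p).
have -> : \tr (invmx (g i p) *m (vector_jac v i p *m g i p))
    = \tr (vector_jac v i p).
  by rewrite mxtrace_mulC -mulmxA mulmxV ?mulmx1 ?metric_unitmx.
have -> : \tr (invmx (g i p) *m (g i p *m (vector_jac v i p)^T))
    = \tr (vector_jac v i p).
  by rewrite mulmxA mulVmx ?mul1mx ?mxtrace_tr ?metric_unitmx.
by field.
Qed.

End Volume.

(** A function on [M] must be evaluated in some chart around each point; an arbitrary one is chosen,
    since both densities pick up the same Jacobian factor and the quotient is unaffected. *)
Definition density_ratio mu rho : M -> R :=
  fun p => let i := sval (cid (dom_cover A p)) in mu i p / rho i p.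

Section Ratio.
Variables (mu rho : A -> M -> R).
Hypotheses (muF : density_fields mu) (rhoF : densities rho).

Lemma density_ratioE i p : dom i p -> density_ratio mu rho p = mu i p / rho i p.
Proof.
move=> ip; rewrite /density_ratio; case: (cid _) => j /= jp.
have [[_ _ rT] r0] := rhoF; have [_ _ mT] := muF.
have J0 : `|\det (Jac j i p)| != 0.
  by have := r0 j p jp; rewrite (rT j i p jp ip) pmulr_rgt0 ?r0 // => /gt_eqF->.
rewrite (rT j i p jp ip) (mT j i p jp ip).
by field; rewrite J0 gt_eqF ?r0.
Qed.

Lemma density_ratio_smooth : smooth_fun A (density_ratio mu rho).
Proof.
move=> i; have [[_ rs _] r0] := rhoF; have [_ ms _] := muF.
apply: (smooth_on_eq (@oimg i)
  (f := fun x => mu i (param i x) * (rho i (param i x))^-1)).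
  by move=> x /param_dom xi /=; rewrite (density_ratioE xi).
apply: smooth_onM; [exact: oimg| exact: ms|].
by apply: smooth_onV; [exact: oimg| |exact: rs] => x /param_dom; exact: r0.
Qed.

Lemma density_ratioK i p : dom i p -> density_ratio mu rho p * rho i p = mu i p.
Proof.
move=> ip; rewrite (density_ratioE ip) divfK // gt_eqF //.
by case: rhoF => _; apply.
Qed.

End Ratio.

End MetricsDensities.

(** * The submersion *)

Section Submersion.
Variables (R : realType) (d : nat) (M : topologicalType) (A : atlas R d M).
Hypothesis d0 : (0 < d)%N.
Variables (chi : partition_of_unity A) (g0 : A -> M -> 'M[R]_d) (Lambda : R).
Hypothesis Lambda0 : 0 <= Lambda.
Implicit Types (g h eta : A -> M -> 'M[R]_d) (v : A -> M -> 'rV[R]_d).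
Implicit Types (rho xi : A -> M -> R).

Local Notation Dvol := (tangent_map (@vol R d M A)).

Let dN0 : d%:R != 0 :> R. Proof. by rewrite pnatr_eq0 -lt0n. Qed.

(** Scaling a metric by [c] multiplies its volume by [c] to the power [d / 2]; hence the exponent
    [2 / d] on the quotient of the densities. *)
Lemma vol_surj rho : metrics g0 -> densities rho ->
  exists2 g, metrics g & vol g = rho.
Proof.
move=> g0M rhoF; have [[r0 rs rT] rP] := rhoF.
have volF := vol_densities g0M d0.
pose q := density_ratio rho (vol g0).
have q0 p : 0 < q p.
  have [i ip] := dom_cover A p.
  by rewrite /q (density_ratioE rhoF.1 volF ip) divr_gt0 ?rP ?vol_gt0.
have qs : smooth_fun A (fun p => q p `^ (2 / d%:R)).
  move=> i; apply: (@smooth_on_powR _ _ _ _ _ (q \o param i)).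
  - exact: img_open.
  - by move=> x _; exact: q0.
  - exact: (density_ratio_smooth rhoF.1 volF).
have gM : metrics (fun i p => q p `^ (2 / d%:R) *: g0 i p).
  by apply: metricsZ => // p; exact: powR_gt0.
exists (fun i p => q p `^ (2 / d%:R) *: g0 i p) => //.
apply/funext => i; apply/funext => p; have [ip|ip] := EM (dom i p); last first.
  by have [[->]] := vol_densities gM d0 => //; rewrite r0.
rewrite /vol detZ -powR_mulrn ?powR_ge0 // -powRrM divfK // powR_mulrn ?ltW //.
rewrite sqrtrM ?sqr_ge0 // sqrtr_sqr gtr0_norm //.
exact: (density_ratioK rhoF.1 volF ip).
Qed.

Lemma trace_conformal (f : R) n (B : 'M[R]_n) : B \in unitmx ->
  \tr (invmx B *m ((2 / d%:R * f) *: B)) = 2 / d%:R * f * n%:R.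
Proof. by move=> Bu; rewrite -scalemxAr mulVmx // mxtraceZ mxtrace1. Qed.

Lemma Dvol_surj g xi : metrics g -> density_fields xi ->
  exists2 eta, sym2_fields eta & Dvol g eta = xi.
Proof.
move=> gM xiF; have volF := vol_densities gM d0.
pose f := density_ratio xi (vol g).
have sf : smooth_fun A f by exact: density_ratio_smooth.
(* The trace of [g^-1 g] is [d], so the factor [2 / d] cancels both this trace and the one half in
   the derivative of [vol]. *)
have hF : sym2_fields (fun i p => (2 / d%:R * f p) *: g i p).
  apply: sym2_fieldsZ gM.1; exact: (smooth_funM (@smooth_fun_cst _ _ _ A _) sf).
exists (fun i p => (2 / d%:R * f p) *: g i p) => //.
apply/funext => i; apply/funext => p; have [ip|ip] := EM (dom i p); last first.
  by have [->] := tangent_vol_density gM hF => //; have [->] := xiF.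
rewrite tangent_volE // trace_conformal ?metric_unitmx //.
rewrite -[RHS](density_ratioK xiF volF ip) -/f; congr (_ * _); field.
exact: dN0.
Qed.

Let WFR g xi := WFR_metric chi g0 Lambda (vol g) xi.
Let WE g eta := WE_metric chi g0 Lambda g eta.

Lemma WFR_le_WE g eta : metrics g -> sym2_fields eta ->
  (WFR g (Dvol g eta) <= WE g eta)%E.
Proof.
move=> gM etaF; have volF := vol_densities gM d0.
apply: le_ereal_inf_tmp => _ [v [h [vF hF etaE ->]]].
have muF := tangent_vol_density gM hF.
(* Defined as a quotient of densities, the half trace is at once a smooth function independent of
   the chart. *)
pose f := density_ratio (Dvol g h) (vol g).
have fE i p : dom i p -> f p = \tr (invmx (g i p) *m h i p) / 2.
  move=> ip; rewrite /f (density_ratioE muF volF ip) tangent_volE // mulfK //.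
  by rewrite gt_eqF // vol_gt0.
pose T i p := \tr (invmx (g i p) *m h i p *m invmx (g i p) *m h i p) * vol g i p.
have fT i p : dom i p -> 4 / d%:R * (f p ^+ 2 * vol g i p) <= T i p.
  move=> ip; rewrite /T mulrA (fE i p ip).
  apply: ler_wpM2r; first by rewrite ltW // vol_gt0.
  have [[_ _ gT _] gP] := gM; have [_ _ hT _] := hF.
  have := sqr_trace_le (gT i p) (gP i p ip) (hT i p).
  rewrite mulrC -ler_pdivrMr ?ltr0n //; apply: le_trans.
  rewrite le_eqVlt; apply/orP; left; apply/eqP; field; exact: dN0.
apply: (@le_trans _ _ (density_integral chi
     (fun i p => (quad (g0 i p) (v i p) * vol g i p)%R)
   + Lambda%:E * density_integral chi (fun i p => (f p ^+ 2 * vol g i p)%R))%E).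
  apply: ereal_inf_lbound; exists v, f; split=> //.
    exact: density_ratio_smooth.
  move=> i p ip; rewrite (density_ratioK muF volF ip) !tangent_volE // etaE //.
  rewrite mulmxDr mulmxN linearD linearN /= mulrDl mulNr mulrDl mulNr.
  by rewrite (tangent_vol_lie gM vF ip).
apply: leeD => //.
(* The constant [4 / d] from the pointwise bound is split off, leaving the weight of the
   Wasserstein--Ebin metric on both sides. *)
have {1}-> : Lambda = d%:R * Lambda / 4 * (4 / d%:R) by field; exact: dN0.
rewrite EFinM -muleA; apply: lee_wpmul2l.
  by rewrite lee_fin divr_ge0 // mulr_ge0.
apply: density_integral_scale_le => //; first by rewrite divr_gt0 // ltr0n.
by move=> i p ip; rewrite mulr_ge0 ?sqr_ge0 // ltW // vol_gt0.
Qed.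

(** No single [eta] is compared with the right-hand side: each competitor [(v, f)] is lifted to its
    own element of the fibre over [xi], whose cost is at most that of [(v, f)]. *)
Lemma WE_inf_le_WFR g xi : metrics g -> density_fields xi ->
  (ereal_inf [set WE g eta | eta in
     [set eta | sym2_fields eta /\ Dvol g eta = xi]] <= WFR g xi)%E.
Proof.
move=> gM xiF; apply: le_ereal_inf_tmp => _ [v [f [vF sf xiE ->]]].
have [xi0 _ _] := xiF.
have hF : sym2_fields (fun i p => (2 / d%:R * f p) *: g i p).
  apply: sym2_fieldsZ gM.1; exact: (smooth_funM (@smooth_fun_cst _ _ _ A _) sf).
pose h : A -> M -> 'M[R]_d := fun i p => (2 / d%:R * f p) *: g i p.
pose eta i p := -1 *: lie_field v g i p + h i p.
have etaF : sym2_fields eta.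
  have LF := lie_field_sym2 vF gM.1.
  exact: (sym2_fieldsD (sym2_fieldsZ (@smooth_fun_cst _ _ _ A (-1)) LF) hF).
have etaE i p : dom i p -> eta i p = - lie_metric v g i p + h i p.
  by move=> ip; rewrite /eta lie_fieldE // scaleN1r.
have DE : Dvol g eta = xi.
  apply/funext => i; apply/funext => p; have [ip|ip] := EM (dom i p); last first.
    by have [->] := tangent_vol_density gM etaF => //; rewrite xi0.
  rewrite tangent_volE // etaE // xiE //.
  rewrite mulmxDr mulmxN linearD linearN /= mulrDl mulNr mulrDl mulNr.
  rewrite (tangent_vol_lie gM vF ip); congr (_ + _ * _).
  by rewrite trace_conformal ?metric_unitmx //; field; exact: dN0.
apply: (@le_trans _ _ (WE g eta)).
  by apply: ereal_inf_lbound; exists eta.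
pose T i p := \tr (invmx (g i p) *m h i p *m invmx (g i p) *m h i p) * vol g i p.
(* Here [g^-1 h] is the scalar matrix [2 f / d], so the trace of its square is [d (2 f / d)^2]. *)
have TE i p : dom i p -> T i p = 4 / d%:R * (f p ^+ 2 * vol g i p).
  move=> ip; have hE : invmx (g i p) *m h i p = (2 / d%:R * f p)%:M.
    by rewrite /h -scalemxAr mulVmx ?metric_unitmx // scalemx1.
  rewrite /T -(mulmxA (_ *m _)) hE -scalar_mxM mxtrace_scalar -[_ *+ d]mulr_natr.
  by field; exact: dN0.
apply: (@le_trans _ _ (density_integral chi
     (fun i p => (quad (g0 i p) (v i p) * vol g i p)%R)
   + (d%:R * Lambda / 4)%:E * density_integral chi T)%E).
  by apply: ereal_inf_lbound; exists v, h.
apply: leeD => //.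
have -> : d%:R * Lambda / 4 = Lambda * (d%:R / 4) by field.
rewrite EFinM -muleA; apply: lee_wpmul2l; first by rewrite lee_fin.
apply: density_integral_scale_le => [|i p ip|i p ip].
- by rewrite divr_gt0 // ltr0n.
- rewrite TE // mulr_ge0 ?divr_ge0 // mulr_ge0 ?sqr_ge0 //.
  by rewrite ltW // vol_gt0.
- by rewrite TE // le_eqVlt; apply/orP; left; apply/eqP; field; exact: dN0.
Qed.

End Submersion.

Unset Implicit Arguments.

Theorem theorem5p6 (R : realType) (d : nat) (hd : (1 <= d)%N)
    (M : topologicalType) (hM : hausdorff_space M)
    (cM : compact [set: M]%classic) (A : atlas R d M)
    (chi : partition_of_unity A)
    (g0 : A -> M -> 'M[R]_d) (hg0 : metrics g0)
    (Lambda : R) (hLambda : 0 <= Lambda) :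
  riemannian_submersion (Met_WE chi g0 Lambda) (Dens_WFR chi g0 Lambda)
    (@vol R d M A).
Proof.
split.
- by move=> g gM; exact: vol_densities.
- move=> g h gM hF; split; last exact: tangent_vol_density.
  move=> i p; have [ip|ip] := EM (dom i p); last by rewrite tangent_vol_out.
  by have [] := is_derive_vol gM h ip.
- by move=> rho rhoF; have [g gM <-] := vol_surj hd hg0 rhoF; exists g.
- move=> g gM xi xiF; have [h hF <-] := Dvol_surj hd gM xiF.
  by exists h.
- move=> g xi gM xiF; apply/eqP; rewrite eq_le; apply/andP; split.
    apply: le_ereal_inf_tmp => _ [h [hF <-] <-]; exact: WFR_le_WE.
  exact: WE_inf_le_WFR.
Qed.
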